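(* Let $(R_\alpha)$ together with a parameter choice rule $\alpha=\alpha(\delta)$ or $\alpha=\alpha(\delta,y^\delta)$ be a (deterministic) regularization method for the equation $F(x)=y$, as defined in the context. For $\eta>0$ let $y^\eta=y+\epsilon(\eta)$, where $\epsilon(\eta)$ is a $\mathcal{Y}$-valued stochastic error such that $\rho_K(y,y^\eta)\to 0$ as $\eta\to 0$. Assume that $F(x)=y$ has a unique solution $x^\dagger$, and that all assumptions needed for the deterministic theory, except the bound on the noise, hold with probability one (i.e. $y^\eta\in\mathcal{A}$ almost surely for every $\eta$). Let $R_\alpha(y^\eta)$ be the regularized solution obtained with the same parameter choice rule as in the deterministic setting, with $\delta$ replaced by $\rho_K(y,y^\eta)$. Then $$\lim_{\eta\to 0}\rho_K(x^\dagger,R_\alpha(y^\eta))=0.$$ If, in addition, the regularized solutions $R_\alpha(y^\eta)$ are defined by truncation as described in the context, then $$\lim_{\eta\to 0}\mathbb{E}\bigl(d_{\mathcal{X}}(x^\dagger,R_\alpha(y^\eta))\bigr)=0.$$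
   Context: Setting. $\mathcal{X},\mathcal{Y}$ are Banach (or Hilbert) spaces with metrics $d_{\mathcal{X}},d_{\mathcal{Y}}$ (typically induced by the norms), $F:\mathcal{D}(F)\subset\mathcal{X}\to\mathcal{Y}$ is a (in general nonlinear) operator, and $y\in\mathcal{Y}$ is the exact data. $F$, $y$ and $x^\dagger$ are deterministic. $(\Omega,\mathcal{F},\mathbb{P})$ is a complete probability space; all random quantities are defined on it, and all maps whose probabilities or expectations are taken are assumed measurable. Ky Fan metric. For random variables $X_1,X_2$ with values in a metric space $(\chi,d_\chi)$, $\rho_K(X_1,X_2):=\inf\{\varepsilon>0:\mathbb{P}(d_\chi(X_1,X_2)>\varepsilon)<\varepsilon\}$; deterministic elements are viewed as constant random variables. Deterministic regularization method. This consists of (possibly nonlinear) maps $R_\alpha:\mathcal{D}(R_\alpha)\subset\mathcal{Y}\to\mathcal{X}$, $\alpha>0$, a parameter choice rule assigning to each noise level $\delta>0$ and data $y^\delta$ a value $\alpha=\alpha(\delta)$ (a priori) or $\alpha=\alpha(\delta,y^\delta)$ (a posteriori), and a set $\mathcal{A}\subset\mathcal{Y}$ of data satisfying the assumptions of the deterministic theory other than the noise bound (in particular $R_\alpha(y^\delta)$ is defined for $y^\delta\in\mathcal{A}$ and the chosen $\alpha$), such that $d_{\mathcal{X}}(R_\alpha(y^\delta),x^\dagger)\to 0$ as $\delta\to 0$ for all families of data $y^\delta\in\mathcal{A}$ with $d_{\mathcal{Y}}(y,y^\delta)\le\delta$, where $\alpha$ is given by the rule. The value substituted for $\delta$ in the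 rule is understood to be positive. Truncation. Here $\mathcal{X}$ is a normed space of functions, $d_{\mathcal{X}}$ is induced by its norm, and the true solution satisfies $\|x^\dagger\|\le\varrho$ and $|x^\dagger|\le C$ globally (pointwise) for some fixed $\varrho,C>0$. Let $C_1,C_2>1$. The regularized solutions are defined by truncation if, for underlying regularized solutions $x^\eta$, one sets $$R_\alpha(y^\eta)=\begin{cases}x^\eta,&\|x^\eta\|\le C_1\varrho\ \text{and}\ |x^\eta|\le C_2C,\\ 0,&\text{otherwise.}\end{cases}$$ *)

(* Defs.v *)
From HB Require Import structures.
From mathcomp Require Import all_boot all_order all_algebra.
From mathcomp Require Import all_classical all_reals all_analysis.
Import Order.TTheory GRing.Theory Num.Theory.
Import numFieldNormedType.Exports.

Set Implicit Arguments.
Unset Strict Implicit.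
Unset Printing Implicit Defensive.

Local Open Scope classical_set_scope.
Local Open Scope ring_scope.

(* The metrics on the Banach spaces need not be the ones induced by the norms,
   hence an unbundled notion instead of the canonical [metricType] structure. *)
Record is_metric (R : realType) (M : Type) (dist : M -> M -> R) : Prop := {
  metric_ge0 : forall a b, 0 <= dist a b ;
  metric_eq0 : forall a b, dist a b = 0 <-> a = b ;
  metric_sym : forall a b, dist a b = dist b a ;
  metric_triangle : forall a b c, dist a c <= dist a b + dist b c }.

(* The infimum is over a nonempty set bounded below (2 belongs to it, 0 is a
   lower bound), so [inf] is the genuine one. *)
Definition ky_fan (R : realType) (d : measure_display) (Omega : measurableType d)
    (P : probability Omega R) (M : Type) (dist : M -> M -> R)
    (X1 X2 : Omega -> M) : R :=
  inf [set e : R | 0 < e /\ (P [set w | (e < dist (X1 w) (X2 w))%R] < e%:E)%E].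

Section regularization.
Variables (R : realType) (X Y : completeNormedModType R).

(* [Rg a] is the map R_a; it is only meaningful on its domain [DR a].
   [alpha delta z] is the parameter chosen for noise level [delta] and data [z];
   a priori rules are those for which it does not depend on [z]. *)
Definition regularized (Rg : R -> Y -> X) (alpha : R -> Y -> R)
    (delta : R) (z : Y) : X :=
  Rg (alpha delta z) z.

(* [A] is the set of data satisfying the deterministic assumptions other than
   the noise bound. *)
Record regularization_method (dX : X -> X -> R) (dY : Y -> Y -> R)
    (y : Y) (xdag : X) (DR : R -> set Y) (Rg : R -> Y -> X)
    (alpha : R -> Y -> R) (A : set Y) : Prop := {
  regularization_defined : forall (delta : R) (z : Y), 0 < delta -> A z ->
    0 < alpha delta z /\ DR (alpha delta z) z ;
  regularization_cvg : forall ydelta : R -> Y,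
    (forall delta, 0 < delta -> A (ydelta delta) /\ dY y (ydelta delta) <= delta) ->
    dX (regularized Rg alpha delta (ydelta delta)) xdag @[delta --> 0^'+] --> 0 }.

(* [ev x] is the element [x] of the function space, seen as a function S -> V;
   [r] bounds the norm and [c] the pointwise modulus. *)
Definition truncation (S : Type) (V : normedModType R) (ev : X -> S -> V)
    (r c : R) (x : X) : X :=
  if `[< `|x| <= r /\ forall s, `|ev x s| <= c >] then x else 0.

End regularization.

(* Main.v *)
Require Import Defs.
From HB Require Import structures.
From mathcomp Require Import all_boot all_order all_algebra.
From mathcomp Require Import all_classical all_reals all_analysis.
From mathcomp Require Import measurable_realfun.
Import Order.TTheory GRing.Theory Num.Theory.
Import numFieldNormedType.Exports.
Set Implicit Arguments.
Unset Strict Implicit.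
Unset Printing Implicit Defensive.
Local Open Scope classical_set_scope.
Local Open Scope ring_scope.

(** Evaluate the deterministic theory at the noise level [delta = ky_fan y yeta].
    The infimum in the Ky Fan metric is attained in the weak sense
    [P (dY y yeta > delta) <= delta] ([ky_fan_tail]), so outside an event of
    probability at most [delta] the random data are, almost surely, admissible
    deterministic data with noise level [delta].

    The deterministic hypothesis speaks of one family of data at a time, whereas
    at a fixed [eta] the data [yeta] take many values.  It is therefore first
    made uniform ([regularization_uniform]): if the error failed to be small
    uniformly over the admissible data of level [delta], then selecting a
    violating datum at every level where there is one would give a family along
    which the method does not converge.  Such a family needs an admissible datum
    at every level; these exist because [yeta] is itself admissible and
    [delta]-close to [y] with positive probability
    ([admissible_data_exist]).  Hence the error exceeds [e] with probability at
    most [delta], which tends to [0]: convergence in probability, that is, in the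
    Ky Fan metric.

    Truncation bounds the error almost surely by a constant [K], and then its
    expectation is at most [e + K * P (error > e)]
    ([ae_bounded_expectation_le]), which is a bounded convergence argument. *)

(** * Tail events and the expectation of bounded functions *)

Section tail_events.
Variables (R : realType) (d : measure_display) (Omega : measurableType d).

Lemma measurable_fun_gt (f : Omega -> R) (e : R) :
  measurable_fun setT f -> measurable [set w | e < f w].
Proof.
move=> mf; have := mf measurableT `]e, +oo[%classic (measurable_itv _).
rewrite setTI; congr measurable; apply/seteqP; split=> w /=;
  by rewrite in_itv /= andbT.
Qed.

Lemma ae_le_measure (mu : {measure set Omega -> \bar R}) (A B : set Omega) :
  measurable A -> measurable B -> {ae mu, forall w, A w -> B w} ->
  (mu A <= mu B)%E.
Proof.
move=> mA mB [N [mN N0 sub]].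
have AsubBN : A `<=` B `|` N.
  move=> w Aw; have [Bw|nBw] := pselect (B w); [by left|right].
  by apply: sub => /= AB; apply: nBw; apply: AB.
have mBN : measurable (B `|` N) by apply: measurableU.
apply: (le_trans (le_measure _ _ _ AsubBN)); rewrite ?inE//.
by rewrite -[leRHS]adde0 -N0; apply: measureU2.
Qed.

Variable P : probability Omega R.

(** Split the integral at the level [e]: the integrand is at most [e] off the
    tail event and at most [K] on it. *)
Lemma ae_bounded_expectation_le (f : Omega -> R) (e K : R) :
  measurable_fun setT f -> (forall w, 0 <= f w) -> 0 <= e -> 0 <= K ->
  {ae P, forall w, f w <= K} ->
  ('E_P[f] <= e%:E + K%:E * P [set w | (e < f w)%R])%E.
Proof.
move=> mf f0 e0 K0 fK; rewrite unlock.
set S := [set w | _]; have mS : measurable S by apply: measurable_fun_gt.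
have -> : (e%:E + K%:E * P S = \int[P]_w (e%:E + K%:E * (\1_S w)%:E))%E.
  rewrite ge0_integralD//=.
  - rewrite integral_cst// [X in (e%:E * X)%E](_ : _ = 1%E) ?mule1; last first.
      exact: (probability_setT P).
    rewrite ge0_integralZl_EFin//=; first by rewrite integral_indic// setIT.
    by apply/measurable_EFinP; exact: measurable_indic.
  - by move=> w _; rewrite -EFinM lee_fin mulr_ge0.
  - by apply: measurable_funeM; apply/measurable_EFinP; exact: measurable_indic.
apply: ae_ge0_le_integral => //=.
- by move=> w _; rewrite lee_fin f0.
- by apply/measurable_EFinP.
- by move=> w _; rewrite -EFinM -EFinD lee_fin addr_ge0// mulr_ge0.
- apply: emeasurable_funD => //.
  by apply: measurable_funeM; apply/measurable_EFinP; exact: measurable_indic.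
- apply: filterS fK => w fwK _; rewrite -EFinM -EFinD lee_fin indicE.
  have [/set_mem Sw|/negP nSw] := boolP (w \in S).
    by rewrite mulr1 (le_trans fwK)// lerDr.
  by rewrite mulr0 addr0 leNgt; apply/negP => efw; apply: nSw; rewrite inE.
Qed.

End tail_events.

(** * The Ky Fan metric *)

Section ky_fan_metric.
Variables (R : realType) (d : measure_display) (Omega : measurableType d).
Variables (P : probability Omega R) (M : Type) (dist : M -> M -> R).
Variables (X1 X2 : Omega -> M).

Lemma ky_fan_le (e : R) :
  0 < e -> (P [set w | (e < dist (X1 w) (X2 w))%R] < e%:E)%E ->
  ky_fan P dist X1 X2 <= e.
Proof. by move=> e0 Pe; apply: ge_inf => //; exists 0 => x [/ltW]. Qed.

Hypothesis mdist : measurable_fun setT (fun w => dist (X1 w) (X2 w)).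

(** [2] exceeds every probability, whence the infimum is over a nonempty set. *)
Lemma ky_fan_has_inf : has_inf
  [set e : R | 0 < e /\ (P [set w | (e < dist (X1 w) (X2 w))%R] < e%:E)%E].
Proof.
split; last by exists 0 => x [/ltW].
exists 2; split=> //.
have m2 : measurable [set w | 2 < dist (X1 w) (X2 w)].
  exact: measurable_fun_gt.
by apply: (le_lt_trans (probability_le1 P m2)); rewrite lte_fin ltr1n.
Qed.

Lemma ky_fan_ge0 : 0 <= ky_fan P dist X1 X2.
Proof.
have [ne _] := ky_fan_has_inf.
by apply: lb_le_inf => // x [/ltW].
Qed.

(** The event [dist > ky_fan] is the increasing union of the events
    [dist > ky_fan + 1 / n.+1], and each of these already has probability at most
    [ky_fan], because the infimum is approached by levels [e] below
    [ky_fan + 1 / n.+1]. *)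
Lemma ky_fan_tail :
  (P [set w | (ky_fan P dist X1 X2 < dist (X1 w) (X2 w))%R]
     <= (ky_fan P dist X1 X2)%:E)%E.
Proof.
set k := ky_fan _ _ _ _; pose D w := dist (X1 w) (X2 w).
pose S (n : nat) := [set w | k + n.+1%:R^-1 < D w].
have mS n : measurable (S n) by apply: measurable_fun_gt.
have -> : [set w | k < dist (X1 w) (X2 w)] = \bigcup_n S n.
  apply/seteqP; split=> w /=; first by case/ltr_add_invr => n ?; exists n.
  by case=> n _; apply: lt_trans; rewrite ltrDl invr_gt0.
have PS n : (P (S n) <= k%:E)%E.
  apply/lee_addgt0Pr => e e0.
  have t0 : 0 < Num.min e n.+1%:R^-1 by rewrite lt_min e0 invr_gt0 ltr0n.
  have [a [a0 Pa]] := inf_adherent t0 ky_fan_has_inf.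
  rewrite -/(ky_fan P dist X1 X2) -/k => ak.
  have ae : a < k + e by rewrite (lt_le_trans ak)// lerD2l ge_min lexx.
  have an : a < k + n.+1%:R^-1.
    by rewrite (lt_le_trans ak)// lerD2l ge_min lexx orbT.
  have ma : measurable [set w | a < D w] by apply: measurable_fun_gt.
  have Sa : S n `<=` [set w | a < D w] by move=> w /=; apply: lt_trans.
  apply: (le_trans (le_measure P _ _ Sa)); rewrite ?inE//.
  by apply: (le_trans (ltW Pa)); rewrite -EFinD lee_fin ltW.
have Shomo : {homo S : m n / (m <= n)%N >-> (m <= n)%O}.
  move=> m n mn; apply/subsetPset => w /=; apply: le_lt_trans.
  by rewrite lerD2l lef_pV2 ?posrE ?ltr0n// ler_nat ltnS.
have cvgS := nondecreasing_cvg_mu (mu := P) mS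
  (bigcup_measurable (fun n _ => mS n)) Shomo.
rewrite -(cvg_lim _ cvgS)//.
apply: lime_le; first by apply/cvg_ex; eexists; exact: cvgS.
by apply: nearW => n /=.
Qed.

End ky_fan_metric.

(** * Uniform convergence of a regularization method *)

Section uniform_regularization.
Variables (R : realType) (X Y : completeNormedModType R).
Variables (dX : X -> X -> R) (dY : Y -> Y -> R) (y : Y) (xdag : X).
Variables (DR : R -> set Y) (Rg : R -> Y -> X) (alpha : R -> Y -> R).
Variable A : set Y.
Hypothesis reg : regularization_method dX dY y xdag DR Rg alpha A.

(** Without admissible data at some level [delta] there would be no family of
    data at all and the convergence hypothesis would be void; hence the
    assumption. *)
Lemma regularization_uniform (e : R) :
  (forall delta, 0 < delta -> exists z, A z /\ dY y z <= delta) -> 0 < e ->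
  exists2 r, 0 < r & forall delta z, 0 < delta < r -> A z -> dY y z <= delta ->
    dX (regularized Rg alpha delta z) xdag <= e.
Proof.
move=> data e0.
pose good delta z := A z /\ dY y z <= delta.
pose bad delta z := good delta z /\ ~ dX (regularized Rg alpha delta z) xdag <= e.
(* A worst family: a violating datum wherever there is one. *)
have [z zP] : exists z : R -> Y, forall delta, 0 < delta ->
    good delta (z delta) /\ ((exists z', bad delta z') -> bad delta (z delta)).
  suff /choice[z zP] : forall delta, exists z, 0 < delta ->
      good delta z /\ ((exists z', bad delta z') -> bad delta z) by exists z.
  move=> delta; have [[z' bz']|nbad] := pselect (exists z', bad delta z').
    by exists z' => _; split=> //; case: bz'.
  have [d0|d0] := boolP (0 < delta); last by exists y.
  by have [z' gz'] := data _ d0; exists z' => _; split.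
have zgood delta : 0 < delta -> good delta (z delta) by move=> /zP[].
have /cvgrPdist_le/(_ e e0) := regularization_cvg reg zgood.
case=> r /= r0 rP; exists r => // delta z' /andP[d0 dr] Az' dz'.
apply: contrapT => nle.
have [_ zbad] : bad delta (z delta) by apply: (zP _ d0).2; exists z'.
apply: zbad; have : ball 0 r delta by rewrite /ball /= sub0r normrN gtr0_norm.
move/rP => /(_ d0); rewrite sub0r normrN; apply: le_trans; exact: ler_norm.
Qed.

End uniform_regularization.

(** * Random data at the noise level given by the Ky Fan metric *)

Section random_data.
Variables (R : realType) (d : measure_display) (Omega : measurableType d).
Variables (P : probability Omega R) (Y : Type) (dY : Y -> Y -> R).
Variables (y : Y) (A : set Y) (Z : Omega -> Y).
Hypothesis mZ : measurable_fun setT (fun w => dY y (Z w)).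
Hypothesis AZ : {ae P, forall w, A (Z w)}.

(** At level [min delta (1 / 2)] the noise event has probability below [1]; were
    no admissible datum that close to [y], it would be almost sure. *)
Lemma admissible_data_exist (delta : R) :
  0 < delta -> ky_fan P dY (cst y) Z < Num.min delta 2^-1 ->
  exists z, A z /\ dY y z <= delta.
Proof.
move=> d0; set k := ky_fan _ _ _ _; rewrite lt_min => /andP[kd k2].
apply: contrapT => none.
have : (P setT <= P [set w | (k < dY (cst y w) (Z w))%R])%E.
  apply: ae_le_measure => //; first exact: measurable_fun_gt.
  apply: filterS AZ => w AZw _ /=; rewrite ltNge; apply/negP => yZ.
  by apply: none; exists (Z w); split=> //; rewrite (le_trans yZ)// ltW.
rewrite probability_setT => /le_trans/(_ (ky_fan_tail (X1 := cst y) P mZ)).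
rewrite lee_fin leNgt => /negP; apply.
by rewrite (lt_trans k2)// invf_lt1// ltr1n.
Qed.

(** A deterministic error bound at noise level [ky_fan y Z] fails only on the
    tail event of the noise. *)
Lemma deterministic_error_tail (f : Y -> R) (e : R) :
  measurable_fun setT (fun w => f (Z w)) ->
  (forall z, A z -> dY y z <= ky_fan P dY (cst y) Z -> f z <= e) ->
  (P [set w | (e < f (Z w))%R] <= (ky_fan P dY (cst y) Z)%:E)%E.
Proof.
move=> mf fe; apply: le_trans (ky_fan_tail (X1 := cst y) P mZ).
apply: ae_le_measure; [exact: measurable_fun_gt..|].
apply: filterS AZ => w AZw /=; rewrite !ltNge => /negP efw; apply/negP => yZ.
by apply: efw; apply: fe.
Qed.

End random_data.

(** * Convergence of the regularized solutions *)

Lemma truncation_norm_le (R : realType) (X : completeNormedModType R) (S : Type)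
    (V : normedModType R) (ev : X -> S -> V) (r c : R) (x : X) :
  0 <= r -> `|truncation ev r c x| <= r.
Proof.
by move=> r0; rewrite /truncation; case: asboolP => [[]|]; rewrite ?normr0.
Qed.

Theorem theorem3p3 (R : realType) (X Y : completeNormedModType R)
    (dX : X -> X -> R) (dY : Y -> Y -> R)
    (dX_metric : is_metric dX) (dY_metric : is_metric dY)
    (DF : set X) (F : X -> Y) (y : Y) (xdag : X)
    (xdag_unique_solution : DF `&` [set x | F x = y] = [set xdag])
    (DR : R -> set Y) (Rg : R -> Y -> X) (alpha : R -> Y -> R) (A : set Y)
    (Rg_regularization : regularization_method dX dY y xdag DR Rg alpha A)
    (d : measure_display) (Omega : measurableType d) (P : probability Omega R)
    (P_complete : measure_is_complete P)
    (epsilon : R -> Omega -> Y) :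
  let yeta := fun (eta : R) (w : Omega) => y + epsilon eta w in
  let rho := fun eta : R => ky_fan P dY (cst y) (yeta eta) in
  let xreg := fun (eta : R) (w : Omega) =>
    regularized Rg alpha (rho eta) (yeta eta w) in
  (forall eta, 0 < eta -> measurable_fun setT (fun w => dY y (yeta eta w))) ->
  (forall eta, 0 < eta -> measurable_fun setT (fun w => dX xdag (xreg eta w))) ->
  (forall eta, 0 < eta -> 0 < rho eta) ->
  rho eta @[eta --> 0^'+] --> 0 ->
  (forall eta, 0 < eta -> {ae P, forall w, A (yeta eta w)}) ->
  ky_fan P dX (cst xdag) (xreg eta) @[eta --> 0^'+] --> 0 /\
  (forall (S : Type) (V : normedModType R) (ev : {linear X -> (S -> V)})
      (varrho C C1 C2 : R) (xeta : R -> Omega -> X),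
    injective ev ->
    (forall a b, dX a b = `|a - b|) ->
    0 < varrho -> 0 < C -> 1 < C1 -> 1 < C2 ->
    `|xdag| <= varrho -> (forall s, `|ev xdag s| <= C) ->
    (forall eta, 0 < eta -> {ae P, forall w,
       xreg eta w = truncation ev (C1 * varrho) (C2 * C) (xeta eta w)}) ->
    ('E_P[fun w => dX xdag (xreg eta w)])%E @[eta --> 0^'+] --> 0%E).
Proof.
move=> yeta rho xreg mY mX rho_gt0 rho0 AY.
pose err eta w := dX xdag (xreg eta w).
have err0 eta w : 0 <= err eta w by exact: metric_ge0 dX_metric _ _.
have rho_lt e : 0 < e -> \forall eta \near 0^'+, rho eta < e.
  by move=> e0; apply: cvgr_lt rho0 _ e0.
have data delta : 0 < delta -> exists z, A z /\ dY y z <= delta.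
  move=> d0; have m0 : 0 < Num.min delta 2^-1.
    by rewrite lt_min d0 invr_gt0 ltr0n.
  have /filter_ex[eta [eta0 rhom]] :
      \forall eta \near (0 : R)^'+, 0 < eta /\ rho eta < Num.min delta 2^-1.
    by near=> eta; split; near: eta; [exact: nbhs_right_gt|exact: rho_lt].
  exact (admissible_data_exist (Z := yeta eta) (mY _ eta0) (AY _ eta0) d0 rhom).
have err_tail e : 0 < e ->
    \forall eta \near 0^'+, (P [set w | (e < err eta w)%R] < e%:E)%E.
  move=> e0; have [r r0 rP] := regularization_uniform Rg_regularization data e0.
  near=> eta.
  have eta0 : 0 < eta by near: eta; exact: nbhs_right_gt.
  have rhor : rho eta < r by near: eta; exact: rho_lt.
  have rhoe : rho eta < e by near: eta; exact: rho_lt.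
  apply: (@le_lt_trans _ _ (rho eta)%:E); last by rewrite lte_fin.
  apply: (deterministic_error_tail (Z := yeta eta) (f := fun z =>
    dX xdag (regularized Rg alpha (rho eta) z)) (mY _ eta0) (AY _ eta0)).
    exact: mX.
  move=> z Az yz; rewrite (Defs.metric_sym dX_metric).
  by apply: rP => //; rewrite rho_gt0.
split.
  apply/cvgr0Pnorm_le => e e0; near=> eta.
  have eta0 : 0 < eta by near: eta; exact: nbhs_right_gt.
  rewrite ger0_norm; last by apply: ky_fan_ge0; exact: mX.
  by apply: ky_fan_le => //; near: eta; exact: err_tail.
move=> S V ev varrho C C1 C2 xeta _ dXE varrho0 _ C1gt1 _ xdag_le _ trunc.
pose K := varrho + C1 * varrho.
have C1varrho0 : 0 < C1 * varrho by rewrite mulr_gt0// (lt_trans ltr01).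
have K0 : 0 < K by rewrite addr_gt0.
have errK eta : 0 < eta -> {ae P, forall w, err eta w <= K}.
  move=> eta0; apply: filterS (trunc _ eta0) => w xregE.
  rewrite /err dXE xregE (le_trans (ler_normB _ _))// lerD//.
  by apply: truncation_norm_le; exact: ltW.
have Ele e : 0 < e -> \forall eta \near 0^'+, ('E_P[err eta] <= e%:E)%E.
  (* The level [t] solves [t + K * t = e]. *)
  move=> e0; pose t := e / (1 + K).
  have K10 : 0 < 1 + K by rewrite addr_gt0.
  have t0 : 0 < t by rewrite divr_gt0.
  near=> eta.
  have eta0 : 0 < eta by near: eta; exact: nbhs_right_gt.
  have Pt : (P [set w | (t < err eta w)%R] < t%:E)%E.
    by near: eta; exact: err_tail.
  apply: (le_trans (ae_bounded_expectation_le (mX _ eta0) (err0 eta) (ltW t0)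
    (ltW K0) (errK _ eta0))).
  have -> : e%:E = (t%:E + K%:E * t%:E)%E.
    by rewrite -EFinM -EFinD -[X in X + _]mul1r -mulrDl mulrC divfK// gt_eqF.
  by rewrite leeD2l// lee_wpmul2l ?lee_fin ?ltW.
have E0 eta : (0 <= 'E_P[err eta])%E by exact: expectation_ge0.
apply/fine_cvgP; split.
  near=> eta; rewrite ge0_fin_numE ?(E0 eta)//; apply: le_lt_trans (ltry 1).
  by near: eta; exact: Ele.
apply/cvgr0Pnorm_le => e e0; near=> eta.
have Ee : ('E_P[err eta] <= e%:E)%E by near: eta; exact: Ele.
have Efin : ('E_P[err eta])%E \is a fin_num.
  by rewrite ge0_fin_numE ?(E0 eta)//; apply: le_lt_trans Ee (ltry _).
by rewrite /= ger0_norm ?fine_ge0 ?(E0 eta)// -lee_fin (fineK Efin).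
Unshelve. all: by end_near.
Qed.
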